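(* Let $f(x,y)>0$ be a conformal factor on the unit square torus $\mathbb{R}^2/\mathbb{Z}^2$ and let $\mathcal{G}=f^2\,(dx^2+dy^2)$ be the corresponding metric on $\mathbb{R}^2/\mathbb{Z}^2$. Then $$\operatorname{area}(\mathcal{G}) - \operatorname{sys}(\mathcal{G})^2 \;\geq\; \operatorname{Var}(f) + \tfrac{1}{16}\,\bigl|P_{\mathrm{BA}}(f)\bigr|_1^2 ,$$ where $P_{\mathrm{BA}}(f)$ is the biaxial projection of $f$. Moreover, if $f$ only depends on one of the two variables, then the coefficient $\tfrac1{16}$ can be replaced by $\tfrac14$, i.e. $$\operatorname{area}(\mathcal{G}) - \operatorname{sys}(\mathcal{G})^2 \;\geq\; \operatorname{Var}(f) + \tfrac{1}{4}\,\bigl|P_{\mathrm{BA}}(f)\bigr|_1^2 .$$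
   Context: The systole $\operatorname{sys}(\mathcal{G})$ is the least $\mathcal{G}$-length of a noncontractible loop on the torus; $\operatorname{area}(\mathcal{G})$ is the total area. Expectation and variance are with respect to the measure $dx\,dy$ on $\mathbb{R}^2/\mathbb{Z}^2$ (a probability measure): $E(f)=\int f\,dx\,dy$, $\operatorname{Var}(f)=\int (f-E(f))^2\,dx\,dy$. $|\cdot|_1$ is the $L^1$-norm on $\mathbb{R}^2/\mathbb{Z}^2$ with respect to $dx\,dy$. Biaxial projection: a doubly periodic function $f$ on $\mathbb{R}^2/\mathbb{Z}^2$ is decomposed as $f(x,y)=E(f)+g_f(x)+h_f(y)+k_f(x,y)$, where the single-variable functions $g_f,h_f$ have zero means and $k_f$ has zero mean along every vertical and horizontal unit interval. Explicitly $g_f(x)=\int_0^1 f(x,y)\,dy-E(f)$ and $h_f(y)=\int_0^1 f(x,y)\,dx-E(f)$. Then $P_{\mathrm{BA}}(f)(x,y)=g_f(x)+h_f(y)$. (In terms of the double Fourier series of $f$, this extracts the $(m,n)$-terms with $mn=0$ and $(m,n)\neq(0,0)$.) *)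

(* Defs.v *)
From HB Require Import structures.
From mathcomp Require Import all_boot all_order all_algebra.
From mathcomp Require Import generic_quotient.
From mathcomp Require Import all_classical all_reals all_analysis.
Set Implicit Arguments.
Unset Strict Implicit.
Unset Printing Implicit Defensive.
Import Order.TTheory GRing.Theory Num.Theory.
Import numFieldNormedType.Exports.
Local Open Scope classical_set_scope.
Local Open Scope ring_scope.
Local Open Scope quotient_scope.

Section torus.
Context {R : realType}.

Definition torus_rel : rel (R * R) :=
  [rel p q | (p.1 - q.1 \is a Num.int) && (p.2 - q.2 \is a Num.int)].

Local Lemma torus_rel_refl : reflexive torus_rel.
Proof. by move=> p; rewrite /torus_rel /= !subrr rpred0. Qed.

Local Lemma torus_rel_sym : symmetric torus_rel.
Proof. by move=> p q; rewrite /torus_rel /= -(opprB q.1) -(opprB q.2) !rpredN. Qed.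

Local Lemma torus_rel_trans : transitive torus_rel.
Proof.
move=> q p r; rewrite /torus_rel /= => /andP[pq1 pq2] /andP[qr1 qr2].
rewrite -(subrKA q.1 p.1) -(subrKA q.2 p.2).
by apply/andP; split; apply: rpredD.
Qed.

Definition torus_equiv :=
  EquivRel torus_rel torus_rel_refl torus_rel_sym torus_rel_trans.

End torus.

Definition torus (R : realType) := {eq_quot @torus_equiv R}.

HB.instance Definition _ (R : realType) :=
  Topological.copy (torus R) (quotient_topology (torus R)).
HB.instance Definition _ (R : realType) := Quotient.on (torus R).

Section functions.
Context {R : realType}.

Definition torus_proj (p : R * R) : torus R := \pi_(torus R) p.

(** The doubly periodic function on R^2 given by a function on the torus. *)
Definition torus_pullback (f : torus R -> R) (p : R * R) : R := f (torus_proj p).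

(** The measure dx dy on R^2/Z^2 is that of the fundamental domain
    [0, 1] x [0, 1]. *)
Definition dxdy := (@lebesgue_measure R \x @lebesgue_measure R)%E.

Definition unit_square : set (R * R) := `[0, 1] `*` `[0, 1].

Definition torus_mean (u : R * R -> R) : R := \int[dxdy]_(p in unit_square) u p.

Definition torus_variance (u : R * R -> R) : R :=
  \int[dxdy]_(p in unit_square) (u p - torus_mean u) ^+ 2.

Definition torus_L1norm (u : R * R -> R) : R := \int[dxdy]_(p in unit_square) `|u p|.

Definition biaxial_x (u : R * R -> R) (x : R) : R :=
  (\int[lebesgue_measure]_(y in `[0, 1]) u (x, y)) - torus_mean u.

Definition biaxial_y (u : R * R -> R) (y : R) : R :=
  (\int[lebesgue_measure]_(x in `[0, 1]) u (x, y)) - torus_mean u.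

Definition biaxial (u : R * R -> R) (p : R * R) : R :=
  biaxial_x u p.1 + biaxial_y u p.2.

End functions.

Section metrics.
Context {R : realType}.

(** A metric on the torus is given by its Gram matrix in the coordinates
    (x, y). *)
Definition conformal_metric (f : torus R -> R) (q : torus R) : 'M[R]_2 :=
  (f q ^+ 2)%:M.

Definition area (G : torus R -> 'M[R]_2) : R :=
  \int[dxdy]_(p in unit_square) Num.sqrt (\det (G (torus_proj p))).

Definition C1 (u : R -> R * R) :=
  (forall t, derivable u t 1) /\ continuous (derive1 u).

(** On each closed piece, [c] is the restriction of a C^1 curve. *)
Definition piecewise_C1 (c : R -> R * R) :=
  exists2 s : seq R, itv_partition 0 1 s &
    forall i, (i < size s)%N ->
      exists2 u, C1 u & {in `[nth 0 (0 :: s) i, nth 0 s i], c =1 u}.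

Definition velocity (c : R -> R * R) (t : R) : 'rV[R]_2 :=
  \row_j (if j == 0 then (derive1 c t).1 else (derive1 c t).2).

(** The length of the curve [torus_proj \o c] for [t] in [0, 1]; [velocity c] is
    only meaningful off the finitely many break points of [c]. *)
Definition curve_length (G : torus R -> 'M[R]_2) (c : R -> R * R) : R :=
  \int[lebesgue_measure]_(t in `[0, 1])
    Num.sqrt ((velocity c t *m G (torus_proj (c t)) *m (velocity c t)^T) 0 0).

(** [l] is a loop on [0, 1]; the homotopy to a constant loop is free (no base
    point is fixed), its parameter being the first argument of [H]. *)
Definition contractible (l : R -> torus R) :=
  exists H : R * R -> torus R,
    [/\ {within `[0, 1] `*` `[0, 1], continuous H},
        forall t, t \in `[0, 1] -> H (0, t) = l t,
        forall s, s \in `[0, 1] -> H (s, 0) = H (s, 1) &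
        exists q, forall t, t \in `[0, 1] -> H (1, t) = q].

(** Every piecewise C^1 loop on the torus is [torus_proj \o c] for a piecewise C^1
    curve [c] in the plane, closed modulo Z^2. *)
Definition noncontractible_loop (c : R -> R * R) :=
  [/\ piecewise_C1 c, torus_proj (c 0) = torus_proj (c 1) & ~ contractible (torus_proj \o c)].

(** [inf] is the greatest lower bound, as the set is nonempty and bounded below
    by 0 (all curves are parameterized by [0, 1]). *)
Definition systole (G : torus R -> 'M[R]_2) : R :=
  inf [set curve_length G c | c in noncontractible_loop].

End metrics.

(* Main.v *)
(** A unit horizontal segment projects to a noncontractible loop, so the systole
    [s] is at most [\int f(x, y) dx = E(f) + h_f(y)] for every [y], and likewise
    at most [E(f) + g_f(x)].  Hence [g_f] and [h_f] are bounded below by [- m] with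
    [m = E(f) - s >= 0], that is [|g_f| <= g_f + 2 m] and [|h_f| <= h_f + 2 m];
    as both have zero mean, integrating gives [|P_BA(f)|_1 <= 4 m], and
    [|P_BA(f)|_1 <= 2 m] when one of them vanishes.  Finally
    [area - s^2 - Var(f) = E(f)^2 - s^2 >= m^2]. *)
Require Import Defs.
From mathcomp Require Import all_boot all_order all_algebra.
From mathcomp Require Import all_classical all_reals all_analysis.
From mathcomp Require Import generic_quotient measurable_realfun.
From mathcomp Require Import zify ring lra.
Import Order.TTheory GRing.Theory Num.Theory.
Import numFieldNormedType.Exports.
Local Open Scope classical_set_scope.
Local Open Scope ring_scope.

(** * The projection of the plane onto the torus *)

Lemma torus_projE (R : realType) (p q : R * R) :
  (torus_proj p == torus_proj q) = torus_rel p q.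
Proof.
transitivity (equiv (@torus_equiv R) p q); last by [].
by rewrite -eqmodE; apply/eqP/eqP.
Qed.

Lemma torus_proj_continuous (R : realType) : continuous (@torus_proj R).
Proof. exact: pi_continuous. Qed.

Lemma torus_proj_repr (R : realType) (q : torus R) : torus_proj (repr q) = q.
Proof. exact: reprK. Qed.

(** * Real numbers modulo 1 *)

Lemma int_lt1_eq0 (R : realType) (x : R) : x \is a Num.int -> `|x| < 1 -> x = 0.
Proof.
move=> /intrP[k ->]; rewrite -intr_norm ltrz1 -[1]/(1%:Z) => k1.
by have -> : k = 0 by lia.
Qed.

(** The representative of [a] modulo 1 in the interval [-1/2, 1/2). *)
Definition residue {R : realType} (a : R) : R := a - (Num.floor (a + 2^-1))%:~R.

Lemma residue_int (R : realType) (a : R) : a - residue a \is a Num.int.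
Proof. by rewrite /residue opprB addrC subrK intr_int. Qed.

(** A condition on the class of [a] modulo 1 only, hence insensitive to the choice of a lift. *)
Definition near_int {R : realType} (e a : R) := exists k : int, `|a - k%:~R| < e.

Lemma residue_lt (R : realType) (e a : R) :
  e <= 2^-1 -> near_int e a -> `|residue a| < e.
Proof.
(* Since [e] is at most 1/2, the integer [k] near [a] is the floor of [a + 1/2]. *)
move=> e12 [k ak]; rewrite /residue (@floor_def _ _ k)//.
by move: ak; rewrite intrD ltr_norml; lra.
Qed.

(** * Discrete homotopy invariance of the winding number *)

Section winding.
Context {R : realType} {X : nat -> nat -> R} {m n : nat}.
Hypothesis horizontal_step : forall i j, (i <= m)%N -> (j < n)%N ->
  near_int 4^-1 (X i j.+1 - X i j).
Hypothesis vertical_step : forall i j, (i < m)%N -> (j <= n)%N ->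
  near_int 4^-1 (X i.+1 j - X i j).
Hypothesis rows_closed : forall i, (i <= m)%N -> X i 0 = X i n.

Let winding i := \sum_(0 <= j < n) residue (X i j.+1 - X i j).

Let windingS i : (i < m)%N -> winding i.+1 = winding i.
Proof.
move=> im; apply/eqP; rewrite -subr_eq0 /winding -sumrB.
pose v j := residue (X i.+1 j - X i j).
(* The difference of the two windings telescopes to [v n - v 0], which vanishes because both rows
   are closed. *)
rewrite (eq_big_nat _ _ (F2 := fun j => v j.+1 - v j)).
  by rewrite telescope_sumr// /v (rows_closed i.+1)// (rows_closed i) ?subrr// ltnW.
(* Around one cell of the grid the four steps of absolute value less than [1/4]
   add up to an integer, hence to zero. *)
move=> j /= jn; apply/eqP; rewrite -subr_eq0; apply/eqP/int_lt1_eq0.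
- have := residue_int _ (X i.+1 j.+1 - X i.+1 j).
  have := residue_int _ (X i j.+1 - X i j).
  have := residue_int _ (X i.+1 j.+1 - X i j.+1).
  have := residue_int _ (X i.+1 j - X i j).
  rewrite -/(v j) -/(v j.+1) => a b c d.
  apply: (eq_ind _ (fun x => x \is a Num.int) (rpredB (rpredD b c) (rpredD a d))).
  ring.
- have e12 : (4^-1 : R) <= 2^-1 by lra.
  have := residue_lt _ _ _ e12 (horizontal_step i.+1 j im jn).
  have := residue_lt _ _ _ e12 (horizontal_step i j (ltnW im) jn).
  have := residue_lt _ _ _ e12 (vertical_step i j im (ltnW jn)).
  have := residue_lt _ _ _ e12 (vertical_step i j.+1 im jn).
  rewrite -/(v j) -/(v j.+1) !ltr_norml; lra.
Qed.

Lemma winding_invariant :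
  \sum_(0 <= j < n) residue (X 0 j.+1 - X 0 j) =
  \sum_(0 <= j < n) residue (X m j.+1 - X m j).
Proof.
rewrite -/(winding 0) -/(winding m).
suff: forall i, (i <= m)%N -> winding i = winding 0 by move=> ->.
by elim=> // i IH im; rewrite windingS// IH// ltnW.
Qed.

End winding.

(** * Uniform continuity modulo 1 of maps into the torus *)

(** The number [c (repr q)] need not be continuous in [q], but changing the representative shifts it
    by an integer only. The preimage in the plane is therefore the union over all integers [k] of
    the open conditions [|c p - a - k| < e]. *)
Lemma near_int_open (R : realType) (c : R * R -> R) (e a : R) : continuous c ->
  (forall p q, torus_rel p q -> c p - c q \is a Num.int) ->
  open [set q : torus R | near_int e (c (repr q) - a)].
Proof.
move=> cc cZ.
change (open (@torus_proj R @^-1` [set q : torus R | near_int e (c (repr q) - a)])).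
rewrite (_ : _ @^-1` _ = \bigcup_(k : int) (fun p => c p - a - k%:~R) @^-1` (ball 0 e)).
  apply: bigcup_open => k _; apply: open_comp; last exact: ball_open.
  by move=> p _; apply: cvgB; [apply: cvgB; [exact: cc|exact: cvg_cst]|exact: cvg_cst].
apply/seteqP; split=> p /=.
- have /cZ/intrP[l cl] : torus_rel (repr (torus_proj p)) p.
    by rewrite -torus_projE torus_proj_repr.
  move=> [k ck]; exists (k - l) => //=; rewrite /ball/= sub0r normrN intrB -cl.
  by move: ck; congr (`|_| < _); ring.
- have /cZ/intrP[l cl] : torus_rel (repr (torus_proj p)) p.
    by rewrite -torus_projE torus_proj_repr.
  move=> [k _]; rewrite /ball/= sub0r normrN => ck; exists (k + l); rewrite intrD -cl.
  by move: ck; congr (`|_| < _); ring.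
Qed.

Lemma near_intB (R : realType) (e e' a b : R) :
  near_int e a -> near_int e' b -> near_int (e + e') (a - b).
Proof.
move=> [k ak] [l bl]; exists (k - l).
by move: ak bl; rewrite intrB !ltr_norml; lra.
Qed.

(** Continuity gives a suitable radius at each point of [K], and compactness makes one scale serve
    all points. Closeness is claimed modulo 1 only, as [repr] may jump. *)
Lemma lebesgue_number (R : realType) (c : R * R -> R) (K : set (R * R))
    (H : R * R -> torus R) (e : R) :
  continuous c -> (forall p q, torus_rel p q -> c p - c q \is a Num.int) ->
  compact K -> {within K, continuous H} -> 0 < e ->
  exists n : nat, forall p q, K p -> K q -> ball p n.+1%:R^-1 q ->
    near_int e (c (repr (H q)) - c (repr (H p))).
Proof.
move=> cc cZ cK cH e0.
have [n _ nP] : \forall n \near \oo,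
    K `<=` [set p | forall q, K q -> ball p n.+1%:R^-1 q ->
      near_int e (c (repr (H q)) - c (repr (H p)))].
  have /compact_near_coveringP/near_covering_withinP cov := cK.
  apply: cov => p Kp.
  pose U := [set q : torus R | near_int (e / 2) (c (repr q) - c (repr (H p)))].
  have : nbhs (H p) U.
    apply: open_nbhs_nbhs; split; first exact: near_int_open.
    by exists 0; rewrite !subrr normr0 divr_gt0.
  move/subspace_continuousP : cH => /(_ _ Kp) /[apply].
  rewrite /= /within/= => /nbhs_ballP[r /= r0 rU].
  (* With [x] within [r / 2] of [p] and [y] within [r / 2] of [x], both lie in the ball of radius
     [r] about [p], where the variation from [p] is below [e / 2] modulo 1. *)
  exists (ball p (r / 2), [set n | n.+1%:R^-1 < r / 2]) => /=.
    split; first by apply: nbhsx_ballx; rewrite divr_gt0.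
    have r20 : 0 < r / 2 by rewrite divr_gt0.
    exact: (near_infty_natSinv_lt (PosNum r20)).
  move=> [x n] /= [px nr] Kx y Ky xy.
  have -> : e = e / 2 + e / 2 by lra.
  have -> : c (repr (H y)) - c (repr (H x)) =
      (c (repr (H y)) - c (repr (H p))) - (c (repr (H x)) - c (repr (H p))) by ring.
  apply: near_intB.
    apply: (rU y) => //; have -> : r = r / 2 + r / 2 by lra.
    apply: ball_triangle px _; apply: le_ball xy; exact: ltW.
  by apply: (rU x) => //; apply: le_ball px; lra.
by exists n => p q Kp Kq pq; apply: (nP n _ p) => //=.
Qed.

(** * A criterion for noncontractibility *)

Lemma unit_square_compact (R : realType) : compact (`[0, 1] `*` `[0, 1] : set (R * R)).
Proof. by apply: compact_setX; exact: segment_compact. Qed.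

(* The winding number: [H] is sampled on a fine grid, so that [c] varies along each
   edge by less than [1/4] modulo [1].  The sum of these variations along a row is
   the same for all rows, but it is [1] on the first row and [0] on the last. *)
Lemma noncontractible_lift (R : realType) (c : R * R -> R) (gamma : R -> R * R) :
  continuous c -> (forall p q, torus_rel p q -> c p - c q \is a Num.int) ->
  (forall t, c (gamma t) = t) -> ~ contractible (torus_proj \o gamma).
Proof.
move=> cc cZ cg [H [cH H0 Hper [q H1]]].
have e0 : (0 : R) < 4^-1 by lra.
have [n nP] := lebesgue_number _ _ _ _ _ cc cZ (unit_square_compact R) cH e0.
(* The choice [n.+2] makes the mesh [1/N] strictly smaller than [1/(n+1)], and also at most 1/2,
   which is used at the end. *)
pose N := n.+2; pose g (i : nat) : R := i%:R / N%:R.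
pose X i j := c (repr (H (g i, g j))).
have N0 : (0 : R) < N%:R by rewrite ltr0n.
have g01 i : (i <= N)%N -> g i \in `[0, 1].
  by move=> iN; rewrite in_itv/= divr_ge0//= ler_pdivrMr// mul1r ler_nat.
have gS i : `|g i - g i.+1| < n.+1%:R^-1.
  rewrite /g distrC -mulrBl -natrB// subSnn mul1r ger0_norm ?invr_ge0//.
  by rewrite ltf_pV2 ?posrE// ltr_nat.
have gN : g N = 1 by rewrite /g divff// lt0r_neq0.
have g0 : g 0%N = 0 by rewrite /g mul0r.
have hs i j : (i <= N)%N -> (j < N)%N -> near_int 4^-1 (X i j.+1 - X i j).
  move=> iN jN; apply: nP => /=.
  - by split => /=; apply: g01 => //; exact: ltnW.
  - by split => /=; apply: g01.
  - by split; [apply: ballxx; rewrite invr_gt0|exact: gS].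
have vs i j : (i < N)%N -> (j <= N)%N -> near_int 4^-1 (X i.+1 j - X i j).
  move=> iN jN; apply: nP => /=.
  - by split => /=; apply: g01 => //; exact: ltnW.
  - by split => /=; apply: g01.
  - by split; [exact: gS|apply: ballxx; rewrite invr_gt0].
have cl i : (i <= N)%N -> X i 0 = X i N.
  by move=> iN; rewrite /X g0 gN Hper// g01.
have := winding_invariant hs vs cl.
(* On the last row [H] is constant, so every residue is zero. *)
rewrite [RHS]big_nat_cond [RHS]big1 => [|j /andP[/= jN _]]; last first.
  rewrite /X gN !H1 ?g01// 1?ltnW// subrr /residue add0r.
  by rewrite (@floor_def _ _ 0) ?subrr//=; lra.
rewrite (eq_big_nat _ _ (F2 := fun=> N%:R^-1)) => [|j /= jN].
  rewrite sumr_const_nat subn0 -[X in X = _]mulr_natl divff ?lt0r_neq0// => /eqP.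
  by rewrite oner_eq0.
(* On the first row [X 0 j] agrees with [g j] modulo 1, so the residue differs from [1/N] by an
   integer. This integer is zero, as the residue is below 1/4 in absolute value and [1/N] is at most
   1/2. *)
apply/eqP; rewrite -subr_eq0; apply/eqP/int_lt1_eq0.
  have X0 k : (k <= N)%N -> X 0 k - g k \is a Num.int.
    move=> kN; rewrite /X g0 H0 ?g01//= -[X in _ - X]cg; apply: cZ.
    by rewrite -torus_projE torus_proj_repr.
  have gj : g j.+1 = g j + N%:R^-1 by rewrite /g -natr1 mulrDl mul1r.
  apply: (eq_ind _ (fun x => x \is a Num.int)
    (rpredB (rpredB (X0 _ jN) (X0 _ (ltnW jN))) (residue_int _ (X 0 j.+1 - X 0 j)))).
  rewrite gj; ring.
have e12 : (4^-1 : R) <= 2^-1 by lra.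
have := residue_lt _ _ _ e12 (hs 0%N _ isT jN).
have N2 : N%:R^-1 <= 2^-1 :> R by rewrite lef_pV2 ?posrE// ler_nat.
have : 0 < N%:R^-1 :> R by rewrite invr_gt0.
rewrite !ltr_norml; lra.
Qed.

(** * Straight segments as competitors for the systole *)

Lemma is_derive_line (R : realType) (V : normedModType R) (p v : V) (x : R) :
  is_derive x 1 (fun t : R => p + t *: v) v.
Proof.
have cv : (fun h : R => h^-1 *: ((p + (h *: 1 + x) *: v) - (p + x *: v))) @ 0^' --> v.
  apply: cvg_near_cst; near=> h.
  have h0 : h != 0 by near: h; exact: nbhs_dnbhs_neq.
  rewrite opprD addrACA subrr add0r -scalerBl addrK [h *: 1]mulr1.
  by rewrite scalerA mulVf// scale1r.
by apply: DeriveDef; [exact: cvgP cv|exact: cvg_lim cv].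
Unshelve. all: by end_near. Qed.

Lemma derive1_line (R : realType) (V : normedModType R) (p v : V) (x : R) :
  derive1 (fun t : R => p + t *: v) x = v.
Proof. by rewrite derive1E; have [_ ->] := is_derive_line R V p v x. Qed.

Lemma line_piecewise_C1 (R : realType) (p v : R * R) :
  piecewise_C1 (fun t : R => p + t *: v).
Proof.
exists [:: 1]; first exact: itv_partition1.
move=> i _; exists (fun t : R => p + t *: v) => //; split.
- by move=> t; have [] := is_derive_line R _ p v t.
- have -> : derive1 (fun t : R => p + t *: v) = cst v.
    by apply/funext => t; rewrite derive1_line.
  exact: cst_continuous.
Qed.

Lemma torus_pullback_continuous (R : realType) (f : torus R -> R) :
  continuous f -> continuous (torus_pullback f).
Proof.
move=> fc p; apply: continuous_comp; [exact: torus_proj_continuous|exact: fc].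
Qed.

Lemma curve_length_line (R : realType) (f : torus R -> R) (p v : R * R) :
  (forall q, 0 < f q) -> v.1 ^+ 2 + v.2 ^+ 2 = 1 ->
  curve_length (conformal_metric f) (fun t : R => p + t *: v) =
  \int[lebesgue_measure]_(t in `[0, 1]) torus_pullback f (p + t *: v).
Proof.
move=> f0 v1; apply: eq_Rintegral => t _; rewrite /conformal_metric mul_mx_scalar.
rewrite -scalemxAl mxE mxE !big_ord_recl big_ord0 /= !mxE/= !derive1_line addr0 -!expr2.
by rewrite v1 mulr1 sqrtr_sqr gtr0_norm.
Qed.

(** The segment closes up on the torus because [v] is integral, its length is the integral of [f]
    because [v] is a unit vector, and it is not contractible because [c] recovers its parameter. *)
Lemma systole_le_line (R : realType) (f : torus R -> R) (c : R * R -> R) (p v : R * R) :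
  (forall q, 0 < f q) ->
  continuous c -> (forall p q, torus_rel p q -> c p - c q \is a Num.int) ->
  (forall t, c (p + t *: v) = t) -> v.1 ^+ 2 + v.2 ^+ 2 = 1 ->
  (v.1 \is a Num.int) && (v.2 \is a Num.int) ->
  0 <= systole (conformal_metric f) <=
    \int[lebesgue_measure]_(t in `[0, 1]) torus_pullback f (p + t *: v).
Proof.
move=> f0 cc cZ cl v1 pv; rewrite -curve_length_line//.
have mem : [set curve_length (conformal_metric f) c | c in noncontractible_loop]
    (curve_length (conformal_metric f) (fun t : R => p + t *: v)).
  exists (fun t : R => p + t *: v) => //; split.
  - exact: line_piecewise_C1.
  - apply/eqP; rewrite torus_projE scale0r scale1r addr0 /torus_rel/=.
    by rewrite !opprD !addrA !subrr !add0r !rpredN.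
  - exact: noncontractible_lift cc cZ cl.
have lb : lbound [set curve_length (conformal_metric f) c | c in noncontractible_loop] 0.
  by move=> _ [d _ <-]; apply: Rintegral_ge0 => t _; exact: sqrtr_ge0.
apply/andP; split.
- by apply: lb_le_inf => //; eexists; exact: mem.
- by apply: ge_inf => //; exists 0.
Qed.

(** * Measurability and integrability *)

(** An open set is the union of the countably many boxes with rational centre and radius [1/(k+1)]
    that it contains, and boxes belong to the product sigma-algebra. *)
Lemma open_measurable_plane (R : realType) (U : set (R * R)) :
  open U -> measurable (U : set (measurableTypeR R * measurableTypeR R)).
Proof.
move=> oU.
pose box (w : rat * rat * nat) : set (R * R) :=
  ball (ratr w.1.1 : R) w.2.+1%:R^-1 `*` ball (ratr w.1.2 : R) w.2.+1%:R^-1.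
have -> : U = \bigcup_(w in [set w | box w `<=` U]) box w.
  apply/seteqP; split=> [p Up|p [w /= wU /wU//]].
  have /nbhs_ballP[e /= e0 eU] := open_nbhs_nbhs (conj oU Up).
  have [n] : exists n : nat, n.+1%:R^-1 < e / 2.
    have e20 : 0 < e / 2 by rewrite divr_gt0.
    have [n _ nP] := near_infty_natSinv_lt (PosNum e20).
    by exists n; apply: (nP n) => /=.
  move=> ne; have n0 : (0 : R) < n.+1%:R^-1 by rewrite invr_gt0.
  have approx (x : R) : exists q : rat, ball (ratr q : R) n.+1%:R^-1 x.
    have : x - n.+1%:R^-1 < x + n.+1%:R^-1 by rewrite ltrBlDr -addrA ltrDl addr_gt0.
    move=> /rat_in_itvoo[q]; rewrite in_itv/= => xq; exists q.
    by rewrite /ball/= ltr_distl.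
  have [q1 q1P] := approx p.1; have [q2 q2P] := approx p.2.
  (* The box contains [p], and since its radius is below [e / 2] it lies in the ball of radius [e]
     about [p]. *)
  exists (q1, q2, n) => //= z [/= z1 z2]; apply: eU.
  split; rewrite [e]splitr.
  - apply: (@ball_triangle _ _ (ratr q1 : R)); last exact: (le_ball (ltW ne)).
    by apply: ball_sym; exact: (le_ball (ltW ne)).
  - apply: (@ball_triangle _ _ (ratr q2 : R)); last exact: (le_ball (ltW ne)).
    by apply: ball_sym; exact: (le_ball (ltW ne)).
rewrite bigcup_mkcond; apply: countable_bigcupT_measurable => [|w].
  exact: countableP.
case: ifPn => // _; apply: measurableX; exact: measurable_ball.
Qed.

Lemma continuous_measurable_plane (R : realType) (u : R * R -> R) :
  continuous u -> measurable_fun [set: measurableTypeR R * measurableTypeR R] u.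
Proof.
move=> /continuousP cu; apply: (measurability _ (RGenOpens.measurableE R)).
move=> _ [_ [a [b ->] <-]]; rewrite setTI; apply: open_measurable_plane.
exact/cu/interval_open.
Qed.

Lemma integrable_bounded (R : realType) d (T : measurableType d)
    (mu : {measure set T -> \bar R}) (D : set T) (u : T -> R) (M : R) :
  measurable D -> (mu D < +oo)%E -> measurable_fun setT u ->
  (forall p, `|u p| <= M) -> mu.-integrable D (EFin \o u).
Proof.
move=> mD muD mu_u uM; apply: measurable_bounded_integrable => //.
  exact: measurable_funTS.
by exists M; split; [exact: num_real|move=> x Mx p _; apply: le_trans (uM p) (ltW Mx)].
Qed.

(** * Integration over the unit interval and the unit square *)

Section square_integral.
Context {R : realType}.
(* [lebesgue_measure], hence [dxdy], is a measure on [measurableTypeR R], whose display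
   is not that of the canonical measurable structure of [R]. *)
Notation line := (measurableTypeR R).
Notation plane := (line * line)%type.
Notation leb := (@lebesgue_measure R).
Notation I01 := (`[0, 1]%classic : set R).
Implicit Types (u : R * R -> R) (v : R -> R).

Lemma measurable_unit_square : measurable (@unit_square R : set plane).
Proof. by apply: measurableX; exact: measurable_itv. Qed.

Lemma lebesgue_I01 : leb I01 = 1%E.
Proof. by rewrite lebesgue_measure_itv/= lte01 sube0. Qed.

Lemma dxdy_unit_square : dxdy (@unit_square R) = 1%E.
Proof.
rewrite [LHS]product_measure1E; [|exact: measurable_itv..].
by rewrite [X in (X * _)%E]lebesgue_I01 [X in (_ * X)%E]lebesgue_I01 mule1.
Qed.

Lemma integrable_I01 v M : measurable_fun [set: line] v -> (forall x, `|v x| <= M) ->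
  leb.-integrable I01 (EFin \o v).
Proof.
move=> mv vM; apply: (integrable_bounded _ _ _ _ _ _ M) => //.
by rewrite [X in (X < _)%E]lebesgue_I01 ltry.
Qed.

Lemma integrable_unit_square u M :
  measurable_fun [set: plane] u -> (forall x, `|u x| <= M) ->
  dxdy.-integrable unit_square (EFin \o u).
Proof.
move=> mu uM; apply: (integrable_bounded _ _ _ _ _ _ M) => //.
  exact: measurable_unit_square.
by rewrite [X in (X < _)%E]dxdy_unit_square ltry.
Qed.

Lemma I01_cst (r : R) : \int[leb]_(x in I01) r = r.
Proof. by rewrite Rintegral_cst// [X in fine X]lebesgue_I01 mulr1. Qed.

Lemma unit_square_cst (r : R) : \int[dxdy]_(x in unit_square) r = r.
Proof.
rewrite Rintegral_cst; last exact: measurable_unit_square.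
by rewrite [X in fine X]dxdy_unit_square mulr1.
Qed.

Lemma norm_int_I01_le v M : measurable_fun [set: line] v -> (forall x, `|v x| <= M) ->
  `|\int[leb]_(x in I01) v x| <= M.
Proof.
move=> mv vM; have iv := integrable_I01 v M mv vM.
apply: (le_trans (le_normr_Rintegral _ iv)) => //.
rewrite -[leRHS]I01_cst; apply: le_Rintegral => //.
- exact: integrable_norm.
- exact: (integrable_I01 _ `|M|).
Qed.

Lemma measurable_section_x u x : measurable_fun [set: plane] u ->
  measurable_fun [set: line] (fun y => u (x, y)).
Proof. by move=> mu; exact: measurable_fun_pair2. Qed.

Lemma measurable_section_y u y : measurable_fun [set: plane] u ->
  measurable_fun [set: line] (fun x => u (x, y)).
Proof. by move=> mu; exact: measurable_fun_pair1. Qed.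

(** Tonelli's theorem concerns integrals over the whole line, so [u] is first extended by zero from
    the strip where [y] lies in [0, 1]. *)
Lemma measurable_int_y u : measurable_fun [set: plane] u -> (forall p, 0 <= u p) ->
  measurable_fun [set: line] (fun x => \int[leb]_(y in I01) u (x, y)).
Proof.
move=> mu u0.
suff : measurable_fun [set: line]
    (fun x : R => (\int[leb]_(y in I01) (u (x, y))%:E)%E : \bar R).
  exact: (measurableT_comp (fine_measurable measurableT)).
pose w := (EFin \o u) \_ ([set: line] `*` I01).
have mw : measurable_fun [set: plane] w.
  have mD : measurable ([set: line] `*` I01 : set plane) by exact: measurableX.
  apply/(measurable_restrictT (EFin \o u) mD).
  by apply/measurable_EFinP; exact: measurable_funTS.
rewrite (_ : (fun x => _) = fubini_F leb w); last first.
  apply/funext => x; rewrite integral_mkcond /fubini_F; apply: eq_integral => y _.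
  by rewrite /w /patch/= in_setX in_setT.
apply: measurable_fun_fubini_tonelli_F => // p.
by rewrite /w /patch; case: ifP; rewrite ?lee_fin.
Qed.

Lemma unit_square_int_xy u M :
  measurable_fun [set: plane] u -> (forall p, `|u p| <= M) ->
  \int[dxdy]_(p in unit_square) u p =
  \int[leb]_(x in I01) \int[leb]_(y in I01) u (x, y).
Proof.
move=> mu uM; have iu := integrable_unit_square u M mu uM.
rewrite {1}/Rintegral integral_mkcond -integral12_prod_meas1; last first.
  exact: ((integrable_mkcond _ measurable_unit_square).1 iu).
rewrite {1}/Rintegral [in RHS]integral_mkcond; congr fine.
apply: eq_integral => x _; rewrite /fubini_F /patch.
case: ifPn => xI; last first.
  by rewrite integral0_eq// => y _; rewrite /unit_square in_setX/= (negbTE xI).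
(* The inner real integral hides a [fine], which is harmless because the section of [u] at [x] is
   bounded, hence integrable. *)
rewrite /Rintegral fineK; last first.
  apply: integrable_fin_num => //.
  by apply: (integrable_I01 _ M) => //; exact: measurable_section_x.
rewrite [RHS]integral_mkcond; apply: eq_integral => y _.
by rewrite /unit_square in_setX/= xI.
Qed.

Lemma unit_square_int_yx u M :
  measurable_fun [set: plane] u -> (forall p, `|u p| <= M) ->
  \int[dxdy]_(p in unit_square) u p =
  \int[leb]_(y in I01) \int[leb]_(x in I01) u (x, y).
Proof.
move=> mu uM; have iu := integrable_unit_square u M mu uM.
rewrite {1}/Rintegral integral_mkcond -integral21_prod_meas1; last first.
  exact: ((integrable_mkcond _ measurable_unit_square).1 iu).
rewrite {1}/Rintegral [in RHS]integral_mkcond; congr fine.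
apply: eq_integral => y _; rewrite /fubini_G /patch.
case: ifPn => yI; last first.
  by rewrite integral0_eq// => x _; rewrite /unit_square in_setX/= (negbTE yI) andbF.
rewrite /Rintegral fineK; last first.
  apply: integrable_fin_num => //.
  by apply: (integrable_I01 _ M) => //; exact: measurable_section_y.
rewrite [RHS]integral_mkcond; apply: eq_integral => x _.
by rewrite /unit_square in_setX/= yI andbT.
Qed.

Lemma measurable_int_x u : measurable_fun [set: plane] u -> (forall p, 0 <= u p) ->
  measurable_fun [set: line] (fun y => \int[leb]_(x in I01) u (x, y)).
Proof.
move=> mu u0; apply: (measurable_int_y (fun p => u (p.2, p.1))) => [|p]; last exact: u0.
by apply: (measurableT_comp mu); apply: measurable_fun_pair.
Qed.

(** * Variance and biaxial projection of a bounded nonnegative function *)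

Section biaxial.
Variables (u : R * R -> R) (M : R).
Hypotheses (mu : measurable_fun [set: plane] u) (u_ge0 : forall p, 0 <= u p).
Hypothesis u_le : forall p, u p <= M.

Let uM p : `|u p| <= M. Proof. by rewrite ger0_norm. Qed.

Let iu : dxdy.-integrable unit_square (EFin \o u).
Proof. exact: (integrable_unit_square _ M). Qed.

(** Since the area is the integral of [f^2], this turns area minus variance into the square of the
    mean. *)
Lemma variance_mean :
  torus_variance u = \int[dxdy]_(p in unit_square) u p ^+ 2 - torus_mean u ^+ 2.
Proof.
have icst (r : R) : dxdy.-integrable unit_square (EFin \o (fun=> r)).
  by apply: (integrable_unit_square _ `|r|) => //; exact: measurable_cst.
have iu2 : dxdy.-integrable unit_square (EFin \o (fun p => u p ^+ 2)).
  apply: (integrable_unit_square _ (M ^+ 2)); first exact: measurable_funX.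
  by move=> p; rewrite normrX lerXn2r// nnegrE// (le_trans (u_ge0 p)).
have iuE : dxdy.-integrable unit_square (EFin \o (fun p => torus_mean u *+ 2 * u p)).
  apply: (integrable_unit_square _ (`|torus_mean u *+ 2| * M)) => [|p].
    exact: measurable_funM.
  by rewrite normrM ler_wpM2l.
have mQ := measurable_unit_square.
rewrite /torus_variance.
transitivity (\int[dxdy]_(p in unit_square)
    ((u p ^+ 2 - torus_mean u *+ 2 * u p) + torus_mean u ^+ 2)).
  by apply: eq_Rintegral => p _; ring.
rewrite RintegralD//; last exact: (integrableB mQ iu2 iuE).
rewrite RintegralB// RintegralZl// unit_square_cst -/(torus_mean u); ring.
Qed.

Lemma torus_mean_le : `|torus_mean u| <= M.
Proof.
rewrite /torus_mean (unit_square_int_xy _ M)//; apply: norm_int_I01_le => [|x].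
  exact: measurable_int_y.
by apply: norm_int_I01_le => //; exact: measurable_section_x.
Qed.

Lemma measurable_biaxial_x : measurable_fun [set: line] (biaxial_x u).
Proof. by apply: measurable_funB => //; exact: measurable_int_y. Qed.

Lemma measurable_biaxial_y : measurable_fun [set: line] (biaxial_y u).
Proof. by apply: measurable_funB => //; exact: measurable_int_x. Qed.

Lemma biaxial_x_le x : `|biaxial_x u x| <= M + M.
Proof.
apply: (le_trans (ler_normB _ _)); apply: lerD; last exact: torus_mean_le.
by apply: norm_int_I01_le => //; exact: measurable_section_x.
Qed.

Lemma biaxial_y_le y : `|biaxial_y u y| <= M + M.
Proof.
apply: (le_trans (ler_normB _ _)); apply: lerD; last exact: torus_mean_le.
by apply: norm_int_I01_le => //; exact: measurable_section_y.
Qed.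

Lemma int_biaxial_x : \int[leb]_(x in I01) biaxial_x u x = 0.
Proof.
rewrite RintegralB//.
- by rewrite I01_cst -(unit_square_int_xy _ M)// subrr.
- apply: (integrable_I01 _ M); first exact: measurable_int_y.
  by move=> x; apply: norm_int_I01_le => //; exact: measurable_section_x.
- by apply: (integrable_I01 _ `|torus_mean u|) => //; exact: measurable_cst.
Qed.

Lemma int_biaxial_y : \int[leb]_(y in I01) biaxial_y u y = 0.
Proof.
rewrite RintegralB//.
- by rewrite I01_cst -(unit_square_int_yx _ M)// subrr.
- apply: (integrable_I01 _ M); first exact: measurable_int_x.
  by move=> x; apply: norm_int_I01_le => //; exact: measurable_section_y.
- by apply: (integrable_I01 _ `|torus_mean u|) => //; exact: measurable_cst.
Qed.

Let mbx : measurable_fun [set: plane] (fun p => biaxial_x u p.1).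
Proof. exact: (measurableT_comp measurable_biaxial_x measurable_fst). Qed.

Let mby : measurable_fun [set: plane] (fun p => biaxial_y u p.2).
Proof. exact: (measurableT_comp measurable_biaxial_y measurable_snd). Qed.

Let ibx : dxdy.-integrable unit_square (EFin \o (fun p => biaxial_x u p.1)).
Proof. by apply: (integrable_unit_square _ (M + M)) => // p; exact: biaxial_x_le. Qed.

Let iby : dxdy.-integrable unit_square (EFin \o (fun p => biaxial_y u p.2)).
Proof. by apply: (integrable_unit_square _ (M + M)) => // p; exact: biaxial_y_le. Qed.

Let ib : dxdy.-integrable unit_square (EFin \o biaxial u).
Proof. exact (integrableD measurable_unit_square ibx iby). Qed.

Lemma int_biaxial : \int[dxdy]_(p in unit_square) biaxial u p = 0.
Proof.
rewrite RintegralD//; last exact: measurable_unit_square.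
(* Each summand is integrated first along the variable on which it does not depend, so that the
   inner integral is that of a constant. *)
rewrite (unit_square_int_xy _ (M + M))//; last by move=> p; exact: biaxial_x_le.
rewrite (unit_square_int_yx (fun p => biaxial_y u p.2) (M + M))//; last first.
  by move=> p; exact: biaxial_y_le.
under eq_Rintegral do rewrite /= I01_cst.
rewrite int_biaxial_x add0r.
under eq_Rintegral do rewrite /= I01_cst.
exact: int_biaxial_y.
Qed.

(** The projection has zero mean and the square has measure 1, so the right-hand side integrates to
    [c]. *)
Lemma L1norm_biaxial_le (c : R) :
  (forall p, `|biaxial u p| <= biaxial u p + c) -> torus_L1norm (biaxial u) <= c.
Proof.
have mQ := measurable_unit_square => bc.
have ic : dxdy.-integrable unit_square (EFin \o (fun=> c)).
  by apply: (integrable_unit_square _ `|c|) => //; exact: measurable_cst.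
rewrite -[leRHS]add0r -int_biaxial -[X in _ + X]unit_square_cst -RintegralD//.
apply: le_Rintegral => //.
- exact: integrable_norm.
- exact: (integrableD mQ ib ic).
Qed.

Lemma le_torus_mean (s : R) :
  (forall x, s <= \int[leb]_(y in I01) u (x, y)) -> s <= torus_mean u.
Proof.
move=> su; rewrite /torus_mean (unit_square_int_xy _ M)// -[leLHS]I01_cst.
apply: le_Rintegral => //.
- by apply: (integrable_I01 _ `|s|) => //; exact: measurable_cst.
- apply: (integrable_I01 _ M); first exact: measurable_int_y.
  by move=> x; apply: norm_int_I01_le => //; exact: measurable_section_x.
Qed.

(** All vertical integrals coincide, hence equal their average, which is the mean. *)
Lemma biaxial_x_eq0 : (forall x x' y, u (x, y) = u (x', y)) ->
  forall x, biaxial_x u x = 0.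
Proof.
move=> ux x; rewrite /biaxial_x /torus_mean (unit_square_int_xy _ M)//.
have e x' : \int[leb]_(y in I01) u (x', y) = \int[leb]_(y in I01) u (x, y).
  by apply: eq_Rintegral => y _; exact: ux.
by under [X in _ - X]eq_Rintegral do rewrite e; rewrite I01_cst subrr.
Qed.

Lemma biaxial_y_eq0 : (forall x y y', u (x, y) = u (x, y')) ->
  forall y, biaxial_y u y = 0.
Proof.
move=> uy y; rewrite /biaxial_y /torus_mean (unit_square_int_yx _ M)//.
have e y' : \int[leb]_(x in I01) u (x, y') = \int[leb]_(x in I01) u (x, y).
  by apply: eq_Rintegral => x _; exact: uy.
by under [X in _ - X]eq_Rintegral do rewrite e; rewrite I01_cst subrr.
Qed.

Variable s : R.
Hypothesis le_int_y : forall x, s <= \int[leb]_(y in I01) u (x, y).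
Hypothesis le_int_x : forall y, s <= \int[leb]_(x in I01) u (x, y).

(** If [a] is negative, then [|a| = - a <= m <= a + 2 m]. *)
Let norm_le (a m : R) : 0 <= m -> - m <= a -> `|a| <= a + m *+ 2.
Proof. by move=> m0 ma; rewrite ler_norml; lra. Qed.

Lemma L1norm_biaxial_le4 : torus_L1norm (biaxial u) <= 4 * (torus_mean u - s).
Proof.
have m0 : 0 <= torus_mean u - s by rewrite subr_ge0 le_torus_mean.
apply: L1norm_biaxial_le => p; apply: (le_trans (ler_normD _ _)).
have := norm_le (biaxial_x u p.1) _ m0; have := norm_le (biaxial_y u p.2) _ m0.
have := le_int_y p.1; have := le_int_x p.2.
rewrite /biaxial /biaxial_x /biaxial_y => a b.
by move=> /(_ ltac:(lra)) c /(_ ltac:(lra)) d; lra.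
Qed.

Lemma L1norm_biaxial_le2 :
  (forall x y y', u (x, y) = u (x, y')) \/ (forall x x' y, u (x, y) = u (x', y)) ->
  torus_L1norm (biaxial u) <= 2 * (torus_mean u - s).
Proof.
have m0 : 0 <= torus_mean u - s by rewrite subr_ge0 le_torus_mean.
move=> [/biaxial_y_eq0 e|/biaxial_x_eq0 e]; apply: L1norm_biaxial_le => p;
  rewrite /biaxial e ?addr0 ?add0r mulr_natl; apply: norm_le => //.
- by rewrite /biaxial_x; have := le_int_y p.1; lra.
- by rewrite /biaxial_y; have := le_int_x p.2; lra.
Qed.

End biaxial.

End square_integral.

(** * Area and systole of a conformal metric *)

(** Subtracting floors moves any point into the compact unit square without changing its class, and
    there a maximum is attained. *)
Lemma torus_pullback_bounded (R : realType) (f : torus R -> R) :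
  continuous f -> exists M, forall p, torus_pullback f p <= M.
Proof.
move=> fc; have ne : @unit_square R !=set0.
  by exists (0, 0); split; rewrite /= in_itv/= lexx ler01.
have wc : {within @unit_square R, continuous (torus_pullback f)}.
  by apply: continuous_subspaceT; exact: torus_pullback_continuous.
have [m _ mP] := compact_EVT_max ne (unit_square_compact R) wc.
exists (torus_pullback f m) => p.
have fl (x : R) : x - (Num.floor x)%:~R \in `[0, 1].
  by rewrite in_itv/=; have := floor_itv x; rewrite intrD; lra.
pose q := (p.1 - (Num.floor p.1)%:~R, p.2 - (Num.floor p.2)%:~R).
have -> : torus_pullback f p = torus_pullback f q.
  congr f; apply/eqP; rewrite torus_projE /torus_rel /=.
  by rewrite !opprB ![_ + (_ - _)]addrC !subrK !intr_int.
by apply: mP; apply/mem_set; split; exact: fl.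
Qed.

Lemma area_conformal (R : realType) (f : torus R -> R) :
  area (conformal_metric f) = \int[dxdy]_(p in unit_square) torus_pullback f p ^+ 2.
Proof.
apply: eq_Rintegral => p _; rewrite /conformal_metric det_scalar sqrtr_sqr.
by rewrite ger0_norm// sqr_ge0.
Qed.

Lemma systole_le_horizontal (R : realType) (f : torus R -> R) (y : R) :
  (forall q, 0 < f q) ->
  0 <= systole (conformal_metric f) <=
    \int[lebesgue_measure]_(x in `[0, 1]) torus_pullback f (x, y).
Proof.
move=> f0.
have -> : \int[lebesgue_measure]_(x in `[0, 1]) torus_pullback f (x, y) =
    \int[lebesgue_measure]_(t in `[0, 1]) torus_pullback f ((0, y) + t *: (1, 0)).
  apply: eq_Rintegral => t _; congr torus_pullback.
  by congr pair; rewrite /= ?add0r ?[t *: 1]mulr1 ?scaler0 ?addr0.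
(* The first coordinate is continuous, well defined modulo 1 on the torus, and equal to the
   parameter along the segment. *)
apply: (systole_le_line _ _ fst) => //.
- by move=> p; exact: cvg_fst.
- by move=> p q /andP[].
- by move=> t /=; rewrite add0r [t *: 1]mulr1.
- by rewrite /= expr1n expr0n addr0.
- by rewrite /= rpred0 rpred1.
Qed.

Lemma systole_le_vertical (R : realType) (f : torus R -> R) (x : R) :
  (forall q, 0 < f q) ->
  0 <= systole (conformal_metric f) <=
    \int[lebesgue_measure]_(y in `[0, 1]) torus_pullback f (x, y).
Proof.
move=> f0.
have -> : \int[lebesgue_measure]_(y in `[0, 1]) torus_pullback f (x, y) =
    \int[lebesgue_measure]_(t in `[0, 1]) torus_pullback f ((x, 0) + t *: (0, 1)).
  apply: eq_Rintegral => t _; congr torus_pullback.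
  by congr pair; rewrite /= ?add0r ?[t *: 1]mulr1 ?scaler0 ?addr0.
apply: (systole_le_line _ _ snd) => //.
- by move=> p; exact: cvg_snd.
- by move=> p q /andP[].
- by move=> t /=; rewrite add0r [t *: 1]mulr1.
- by rewrite /= expr1n expr0n add0r.
- by rewrite /= rpred0 rpred1.
Qed.

Theorem theorem7p1 (R : realType) (f : torus R -> R)
    (f_cont : continuous f) (f_gt0 : forall q, 0 < f q) :
  let G := conformal_metric f in
  let F := torus_pullback f in
  (area G - systole G ^+ 2 >=
     torus_variance F + 16^-1 * torus_L1norm (biaxial F) ^+ 2) /\
  ((forall x y y', F (x, y) = F (x, y')) \/
   (forall x x' y, F (x, y) = F (x', y)) ->
   area G - systole G ^+ 2 >=
     torus_variance F + 4^-1 * torus_L1norm (biaxial F) ^+ 2).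
Proof.
move=> G F; have [M FM] := torus_pullback_bounded R f f_cont.
have F0 p : 0 <= F p by exact/ltW/f_gt0.
have mF := continuous_measurable_plane _ _ (torus_pullback_continuous _ _ f_cont).
have s0 : 0 <= systole G by have /andP[] := systole_le_horizontal _ _ 0 f_gt0.
have sx x : systole G <= \int[lebesgue_measure]_(y in `[0, 1]) F (x, y).
  by have /andP[] := systole_le_vertical _ _ x f_gt0.
have sy y : systole G <= \int[lebesgue_measure]_(x in `[0, 1]) F (x, y).
  by have /andP[] := systole_le_horizontal _ _ y f_gt0.
have sE := le_torus_mean F M mF F0 FM _ sx.
have L0 : 0 <= torus_L1norm (biaxial F) by apply: Rintegral_ge0.
have L4 := L1norm_biaxial_le4 F M mF F0 FM _ sx sy.
(* The integral of [F^2] cancels, leaving [E^2 - s^2] to be bounded below, with [E] the mean and [s]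
   the systole. As [0 <= s <= E], it is at least [(E - s)^2]. Squaring the bound [4 (E - s)] or
   [2 (E - s)] on the nonnegative norm gives the coefficients 1/16 and 1/4. *)
rewrite area_conformal (variance_mean F M mF F0 FM).
split=> [|/(L1norm_biaxial_le2 F M mF F0 FM _ sx sy)]; nra.
Qed.
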